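(* Let $X$ be a finite-dimensional Banach space over $\mathbb{F}$ ($\mathbb{F}=\mathbb{R}$ or $\mathbb{C}$) for which the numerical radius $w(\cdot)$ is a norm on $\mathcal{L}(X)$. Let $T\in\mathcal{L}(X)_w$ and let $\mathcal{V}$ be a subspace of $\mathcal{L}(X)_w$. Suppose there exists $S\in\mathscr{L}_{\mathcal{V}}(T)_w$ such that $T-S$ is nu-smooth. Then $$d_w(T,\mathcal{V})=\max\Big\{x^*(Tx) : x\in E_X,\ x^*\in E_{X^*},\ |x^*(x)|=1,\ \Im(x^*(Tx))=0,\ x^*(Ax)=0\ \ \forall A\in\mathcal{V}\Big\}.$$
   Context: For a Banach space $X$ over $\mathbb{F}\in\{\mathbb{R},\mathbb{C}\}$, $X^*$ is its dual and $S_X$ its unit sphere. $E_X$ (resp. $E_{X^*}$) denotes the set of all extreme points of the closed unit ball of $X$ (resp. $X^*$). $\mathcal{L}(X)$ is the space of bounded linear operators on $X$. The numerical radius of $T\in\mathcal{L}(X)$ is $w(T)=\sup\{|x^*(Tx)| : x^*\in S_{X^*},\ x\in S_X,\ x^*(x)=1\}$; only spaces $X$ for which $w(\cdot)$ is a norm on $\mathcal{L}(X)$ are considered. $\mathcal{L}(X)_w$ denotes $\mathcal{L}(X)$ with the norm $w(\cdot)$, and $\mathcal{L}(X)_w^*$ is its dual. For a subspace $\mathcal{V}$ of $\mathcal{L}(X)_w$, $d_w(T,\mathcal{V})=\inf\{w(T-S) : S\in\mathcal{V}\}$ and $\mathscr{L}_{\mathcal{V}}(T)_w=\{S\in\mathcal{V}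 : w(T-S)=d_w(T,\mathcal{V})\}$. For $T\in\mathcal{L}(X)_w$, $J_w(T)=\{f\in\mathcal{L}(X)_w^* : \|f\|=1,\ f(T)=w(T)\}$; $T$ is called nu-smooth if $J_w(T)$ is a singleton. $\Im(\lambda)$ is the imaginary part of $\lambda\in\mathbb{F}$. *)

(* Defs.v *)
From HB Require Import structures.
From mathcomp Require Import all_boot all_order all_algebra.
From mathcomp Require Import complex.
From mathcomp Require Import all_classical all_reals all_analysis.

Set Implicit Arguments.
Unset Strict Implicit.
Unset Printing Implicit Defensive.

Import Order.TTheory GRing.Theory Num.Theory.
Import numFieldNormedType.Exports.

Local Open Scope classical_set_scope.
Local Open Scope ring_scope.

Variant scalar_kind := RealScalars | ComplexScalars.

Definition scalars (R : realType) (k : scalar_kind) : numFieldType :=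
  match k with
  | RealScalars => R : numFieldType
  | ComplexScalars => R[i] : numFieldType
  end.

Definition re (R : realType) (k : scalar_kind) : scalars R k -> R :=
  match k return scalars R k -> R with
  | RealScalars => fun z => z
  | ComplexScalars => fun z => complex.Re z
  end.

Definition im (R : realType) (k : scalar_kind) : scalars R k -> R :=
  match k return scalars R k -> R with
  | RealScalars => fun=> 0
  | ComplexScalars => fun z => complex.Im z
  end.

Definition of_real (R : realType) (k : scalar_kind) : R -> scalars R k :=
  match k return R -> scalars R k with
  | RealScalars => fun r => r
  | ComplexScalars => fun r => Complex r 0
  end.
Arguments of_real {R} k r.

#[short(type="finDimBanachType")]
HB.structure Definition FinDimBanach (K : numFieldType) :=
  {X of CompleteNormedModule K X & Vector K X}.

Section BoundedOperators.
Variables (K : numFieldType) (X Y : normedModType K).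

Definition bounded_linear (f : X -> Y) : Prop :=
  linear f /\ exists M : K, forall x, `|f x| <= M * `|x|.

Definition is_bounded_linear : {pred X -> Y} := fun f => `[< bounded_linear f >].

Lemma bounded_linear_submod : submod_closed is_bounded_linear.
Proof.
split=> [|a f g /asboolP[lf [M Mf]] /asboolP[lg [N Ng]]]; apply/asboolP.
  split=> [b u v|]; first by rewrite /= scaler0 addr0.
  by exists 0 => x; rewrite normr0 mul0r.
split=> [b u v|].
  rewrite !fctE /= lf lg !scalerDr !scalerA (mulrC a b) -!addrA.
  by congr (_ + _); rewrite addrCA.
exists (`|a| * M + N) => x; rewrite !fctE.
apply: (le_trans (ler_normD _ _)); rewrite mulrDl lerD// normrZ -mulrA.
exact: ler_wpM2l.
Qed.

HB.instance Definition _ :=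
  GRing.isSubmodClosed.Build K (X -> Y) is_bounded_linear bounded_linear_submod.

Record bounded_op := BoundedOp {
  bounded_op_fun :> X -> Y ;
  _ : is_bounded_linear bounded_op_fun }.

HB.instance Definition _ := [isSub for bounded_op_fun].
HB.instance Definition _ := [Choice of bounded_op by <:].
HB.instance Definition _ := [SubChoice_isSubLmodule of bounded_op by <:].

End BoundedOperators.

Notation "''L' ( X )" := (bounded_op X X) (format "''L' ( X )") : type_scope.

Section Norms.
Variables (R : realType) (k : scalar_kind).
Local Notation K := (scalars R k).

(* The library's norm takes its values in [K]: a nonnegative element of [K] is
   real, so [re] loses nothing. *)
Definition real_norm (X : normedModType K) (x : X) : R := re `|x|.

Definition is_norm (V : lmodType K) (N : V -> R) : Prop :=
  [/\ forall v, 0 <= N v,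
      forall v, N v = 0 -> v = 0,
      forall (a : K) v, N (a *: v) = re `|a| * N v
    & forall u v, N (u + v) <= N u + N v].

(* The dual of [V] normed by [N], and the dual norm. On the dual, the set whose
   [sup] is taken is bounded, so the junk value of [sup] is not met. *)
Definition dual (V : lmodType K) (N : V -> R) : set (V -> K^o) :=
  [set f | scalar f /\ exists M : R, forall v, re `|f v| <= M * N v].

Definition dual_norm (V : lmodType K) (N : V -> R) (f : V -> K^o) : R :=
  sup [set re `|f v| | v in [set v | N v <= 1]].

(* The order of [R[i]] only compares numbers with equal imaginary parts, so
   [0 < t < 1] makes [t] real. *)
Definition extreme_points (V : lmodType K) (B : set V) : set V :=
  [set x | B x /\ forall (y z : V) (t : K), B y -> B z -> 0 < t < 1 ->
     x = t *: y + (1 - t) *: z -> y = x /\ z = x].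

End Norms.

Section NumericalRadius.
Variables (R : realType) (k : scalar_kind).
Local Notation K := (scalars R k).
Variable X : finDimBanachType K.

Local Notation dualX := (dual (@real_norm R k X)).
Local Notation dualX_norm := (dual_norm (@real_norm R k X)).

Definition sphere_X : set X := [set x | real_norm x = 1].

Definition sphere_dual : set (X -> K^o) :=
  [set f | dualX f /\ dualX_norm f = 1].

Definition extreme_X : set X := extreme_points [set x : X | real_norm x <= 1].

Definition extreme_dual : set (X -> K^o) :=
  extreme_points [set f : X -> K^o | dualX f /\ dualX_norm f <= 1].

(* For [X = 0] the set is empty and [sup] gives [0]. *)
Definition numradius (T : 'L(X)) : R :=
  sup [set r | exists f x, [/\ sphere_dual f, sphere_X x, f x = 1
                             & r = re `|f (T x)|]].

Definition dist_w (T : 'L(X)) (V : {pred 'L(X)}) : R :=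
  inf [set numradius (T - S) | S in [set` V]].

Definition best_approx_w (T : 'L(X)) (V : {pred 'L(X)}) : set 'L(X) :=
  [set S | S \in V /\ numradius (T - S) = dist_w T V].

Definition support_functionals_w (T : 'L(X)) : set ('L(X) -> K^o) :=
  [set F | [/\ dual numradius F, dual_norm numradius F = 1
             & F T = of_real k (numradius T)]].

Definition nu_smooth (T : 'L(X)) : Prop :=
  exists F, support_functionals_w T = [set F].

End NumericalRadius.

Definition is_max d (T : porderType d) (A : set T) (m : T) : Prop :=
  A m /\ ubound A m.

(* Main.v *)
Require Import Defs.
From HB Require Import structures.
From mathcomp Require Import all_boot all_order all_algebra.
From mathcomp Require Import complex lra ring.
From mathcomp Require Import all_classical all_reals all_analysis.

Set Implicit Arguments.
Unset Strict Implicit.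
Unset Printing Implicit Defensive.

Import Order.TTheory GRing.Theory Num.Theory.
Import numFieldNormedType.Exports.

Local Open Scope classical_set_scope.
Local Open Scope ring_scope.

(* Let U = T - S be the smooth point and let Q be the set of pairs (x, f) in
   the two unit balls with |f x| = 1. In real coordinates Q is compact, and
   w(B) is the maximum over Q of the real part of f (B x). Each pair of Q
   maximising Re f (U x) gives a support functional A |-> f (A x) of U, which
   by smoothness is the only one, F.
   - F vanishes on V: as S is a best approximation, for A in V a maximiser of
     U + t A satisfies Re f (A x) >= 0 and Re f (U x) >= w(U) - t w(A); letting
     t tend to 0, compactness gives a maximiser for U with Re f (A x) >= 0.
   - Among the maximisers for U, one of largest Euclidean norm in coordinates
     has both components extreme, since a segment in one of the unit balls
     through its component stays among the maximisers. *)

(** * Real and imaginary parts, uniformly over both scalar fields, and real coordinates *)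

Section Scalars.
Variables (R : realType) (k : scalar_kind).
Local Notation K := (scalars R k).
Implicit Types (a b z : K) (r s : R).

Lemma reD a b : re (a + b) = re a + re b.
Proof. by case: k a b => [//|[? ?] [? ?]]. Qed.

Lemma imD a b : im (a + b) = im a + im b.
Proof. by case: k a b => [? ?|[? ?] [? ?]] //=; rewrite addr0. Qed.

Lemma re_of_realM r z : re (of_real k r * z) = r * re z.
Proof. by case: k z => [//|[? ?]] /=; rewrite mul0r subr0. Qed.

Lemma im_of_realM r z : im (of_real k r * z) = r * im z.
Proof. by case: k z => [?|[? ?]] /=; rewrite ?mulr0 ?mul0r ?addr0. Qed.

Lemma re_of_real r : re (of_real k r) = r.
Proof. by case: k. Qed.

Lemma im_of_real r : im (of_real k r) = 0.
Proof. by case: k. Qed.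

Lemma scalar_eq a b : re a = re b -> im a = im b -> a = b.
Proof. by case: k a b => [//|[? ?] [? ?] /= -> ->]. Qed.

Lemma re0 : re (0 : K) = 0. Proof. by case: k. Qed.
Lemma im0 : im (0 : K) = 0. Proof. by case: k. Qed.
Lemma re1 : re (1 : K) = 1. Proof. by case: k. Qed.
Lemma im1 : im (1 : K) = 0. Proof. by case: k. Qed.

Lemma of_real0 : of_real k (0 : R) = 0.
Proof. by apply: scalar_eq; rewrite ?re_of_real ?im_of_real ?re0 ?im0. Qed.

Lemma of_real1 : of_real k (1 : R) = 1.
Proof. by apply: scalar_eq; rewrite ?re_of_real ?im_of_real ?re1 ?im1. Qed.

Lemma of_realD r s : of_real k (r + s) = of_real k r + of_real k s.
Proof. by apply: scalar_eq; rewrite ?(reD, imD, re_of_real, im_of_real) ?addr0. Qed.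

Lemma of_realN r : of_real k (- r) = - of_real k r.
Proof. by apply/eqP; rewrite -addr_eq0 -of_realD addNr of_real0. Qed.

Lemma scalar_norm z : `|z| = of_real k (re `|z|).
Proof. by case: k z. Qed.

Lemma le_re a b : a <= b -> re a <= re b.
Proof. by case: k a b => [//|a b] /=; rewrite lecE => /andP[]. Qed.

Lemma le_of_real z r : im z = 0 -> re z <= r -> z <= of_real k r.
Proof. by case: k z => [//|z] /= z0 zr; rewrite lecE /= z0 eqxx. Qed.

Lemma re_norm_ge0 z : 0 <= re `|z|.
Proof. by rewrite -re0 le_re. Qed.

Lemma re_normD a b : re `|a + b| <= re `|a| + re `|b|.
Proof. by rewrite -reD le_re // ler_normD. Qed.

Lemma re_normM a b : re `|a * b| = re `|a| * re `|b|.
Proof. by rewrite normrM [`|a|]scalar_norm re_of_realM re_of_real. Qed.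

Lemma sqr_re_norm z : re `|z| ^+ 2 = re z ^+ 2 + im z ^+ 2.
Proof.
case: k z => [z|z] /=; first by rewrite expr0n addr0 real_normK ?num_real.
by case: z => a b /=; rewrite sqr_sqrtr // addr_ge0 ?sqr_ge0.
Qed.

Lemma re_norm_of_real r : re `|of_real k r| = `|r|.
Proof.
apply/eqP; rewrite -(eqrXn2 (ltn0Sn 1)) ?re_norm_ge0 //.
by rewrite sqr_re_norm re_of_real im_of_real expr0n addr0 real_normK ?num_real.
Qed.

Lemma re_norm0 : re `|0 : K| = 0.
Proof. by rewrite normr0 re0. Qed.

Lemma re_norm1 : re `|1 : K| = 1.
Proof. by rewrite normr1 re1. Qed.

Lemma re_norm_eq0 z : re `|z| = 0 -> z = 0.
Proof. by move=> z0; apply/normr0_eq0; rewrite scalar_norm z0 of_real0. Qed.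

Lemma ler_re_norm z : re z <= re `|z|.
Proof.
rewrite (le_trans (ler_norm _))// -ler_sqr ?nnegrE ?re_norm_ge0//.
by rewrite sqr_re_norm real_normK ?num_real// lerDl sqr_ge0.
Qed.

Lemma norm_re1 z : re `|z| = 1 -> `|z| = 1.
Proof. by move=> z1; rewrite scalar_norm z1 of_real1. Qed.

(** The real part never exceeds the modulus, so both equal [r], and the squared modulus leaves
    nothing for the imaginary part. *)
Lemma re_attains_norm z r : re `|z| <= r -> r <= re z -> z = of_real k r.
Proof.
move=> zr rz; have rE : re z = r by apply/le_anti; rewrite rz (le_trans (ler_re_norm _)).
apply: scalar_eq; rewrite ?re_of_real ?im_of_real//.
have r0 : 0 <= r := le_trans (re_norm_ge0 _) zr.
have := sqr_re_norm z; rewrite rE => zE.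
have : re `|z| ^+ 2 <= r ^+ 2 by rewrite ler_sqr ?nnegrE ?re_norm_ge0.
rewrite zE gerDl => im0; apply/eqP; rewrite -sqrf_eq0; apply/eqP/le_anti.
by rewrite im0 sqr_ge0.
Qed.

(** Turns the scalar parameter of [extreme_points] into a real convex coefficient. *)
Lemma scalar_unit_interval (t : K) :
  0 < t < 1 -> exists2 s : R, 0 < s < 1 & t = of_real k s.
Proof.
case: k t => [t t01|[s i]]; first by exists t.
by rewrite !ltcE /= => /andP[/andP[/eqP-> s0] /andP[_ s1]]; exists s; rewrite ?s0.
Qed.

Import VectorInternalTheory.

(** Compactness and continuity are argued on real row vectors. In the complex case the dimension
    doubles: real parts fill the left half, imaginary parts the right half. *)
Lemma real_coordinates (Y : vectType K) :
  exists m (phi : 'rV[R]_m -> Y) (psi : Y -> 'rV[R]_m),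
    [/\ cancel phi psi, cancel psi phi, {morph phi : u v / u + v}
      & forall r u, phi (r *: u) = of_real k r *: phi u].
Proof.
case: k Y => Y /=.
  exists (dim Y), r2v, v2r; split; [exact: r2vK|exact: v2rK|exact: raddfD|].
  by move=> r u; rewrite linearZ.
pose c (u : 'rV[R]_(dim Y + dim Y)) : 'rV[R[i]]_(dim Y) :=
  \row_j Complex (lsubmx u 0 j) (rsubmx u 0 j).
exists (dim Y + dim Y)%N, (r2v \o c), (fun y =>
  row_mx (map_mx (@complex.Re R) (v2r y)) (map_mx (@complex.Im R) (v2r y))).
split=> [u|y|u v|r u] /=.
- rewrite r2vK -[RHS]hsubmxK; congr row_mx;
  by apply/rowP => j; rewrite !mxE.
- rewrite -[RHS]v2rK; congr r2v; apply/rowP => j.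
  by rewrite mxE row_mxKl row_mxKr !mxE; case: (v2r y 0 j).
- by rewrite -raddfD; congr r2v; apply/rowP => j; rewrite !mxE.
- rewrite -linearZ; congr r2v; apply/rowP => j; rewrite !mxE.
  by apply/eqP; rewrite eq_complex /= !mul0r subr0 addr0 !eqxx.
Qed.

End Scalars.

(** * Continuity of quadratic forms and seminorms on real row vectors; compact norm balls *)

Section RealRowVectors.
Variables (R : realType) (m : nat).
Local Notation E := 'rV[R]_m.

(** Expanding both arguments over the standard basis gives a polynomial in the coordinates. *)
Lemma continuous_quadratic (b : E -> E -> R) :
  (forall u v v', b u (v + v') = b u v + b u v') ->
  (forall u u' v, b (u + u') v = b u v + b u' v) ->
  (forall r u v, b u (r *: v) = r * b u v) ->
  (forall r u v, b (r *: u) v = r * b u v) ->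
  continuous (fun u => b u u).
Proof.
move=> bDr bDl bZr bZl.
have b0r u : b u 0 = 0 by rewrite -(scale0r 0) bZr mul0r.
have b0l v : b 0 v = 0 by rewrite -(scale0r 0) bZl mul0r.
have -> : (fun u => b u u) =
    (fun u : E => \sum_i \sum_j u 0 i * (u 0 j * b 'e_i 'e_j)).
  apply/funext => u; rewrite {1 2}(row_sum_delta u).
  rewrite (big_morph (b^~ _) (fun u u' => bDl u u' _) (b0l _)).
  apply: eq_bigr => i _.
  rewrite (big_morph (b _) (bDr _) (b0r _)); apply: eq_bigr => j _.
  by rewrite bZl bZr.
apply: continuous_big => [|i _]; first exact: add_continuous.
apply: continuous_big => [|j _ u]; first exact: add_continuous.
have ci l : {for u, continuous (fun v : E => v 0 l)} by exact: coord_continuous.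
have cij : {for u, continuous (fun v : E => v 0 j * b 'e_i 'e_j)}.
  exact: (continuousM (ci j) (@cst_continuous _ _ _ u)).
exact: (continuousM (ci i) cij).
Qed.

Variable n : E -> R.
Hypotheses (nD : forall u v, n (u + v) <= n u + n v)
           (nZ : forall r u, n (r *: u) = `|r| * n u).

Let n0 : n 0 = 0. Proof. by rewrite -(scale0r 0) nZ normr0 mul0r. Qed.

Lemma seminorm_ge0 u : 0 <= n u.
Proof.
have := nD u ((-1) *: u); rewrite nZ normrN normr1 mul1r scaleN1r subrr n0.
by rewrite -mulr2n pmulrn_lge0.
Qed.

(** By subadditivity [n u] is at most a constant times the norm of [u], so [n] is Lipschitz. *)
Lemma seminorm_continuous : continuous n.
Proof.
have bound u : n u <= `|u| * \sum_i n 'e_i.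
  rewrite {1}(row_sum_delta u) mulr_sumr.
  apply: (@le_trans _ _ (\sum_i n (u 0 i *: 'e_i))).
    by elim/big_ind2 : _ => [||//]; rewrite ?n0 // => a b c d ab cd;
      rewrite (le_trans (nD _ _)) ?lerD.
  apply: ler_sum => i _; rewrite nZ ler_wpM2r ?seminorm_ge0 //.
  by rewrite [leRHS]/Num.Def.normr /= mx_normrE; apply/bigmax_geP; right; exists (0, i).
set C := \sum_i _ in bound.
have C0 : 0 <= C by apply: sumr_ge0 => i _; exact: seminorm_ge0.
have lip u v : `|n u - n v| <= `|u - v| * C.
  have h u' v' : n u' - n v' <= `|u' - v'| * C.
    by rewrite lerBlDr (le_trans _ (lerD (bound _) (lexx _))) // -{1}(subrK v' u').
  by rewrite ler_norml lerNl opprB h distrC h.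
move=> u; apply/(@cvgrPdist_le _ _ _ (nbhs u) (nbhs_filter u)) => e e0.
(* [C] may be 0; [C + 1] can be divided by. *)
near=> v; rewrite (le_trans (lip _ _)) // (@le_trans _ _ (`|u - v| * (C + 1))) //.
  by rewrite ler_wpM2l // lerDl.
rewrite -ler_pdivlMr ?ltr_wpDl //; near: v.
by apply: cvgr_dist_le => //; rewrite divr_gt0 ?ltr_wpDl.
Unshelve. all: by end_near. Qed.

(** Heine-Borel: the minimum of [n] on the compact unit sphere is positive, and its inverse bounds
    the ball of [n]. *)
Lemma norm_ball_compact : (forall u, n u = 0 -> u = 0) ->
  compact [set u | n u <= 1].
Proof.
move=> n_eq0; apply: bounded_closed_compact; last first.
  by apply: (@closed_comp _ _ n [set r | r <= 1]) => [u _|];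
    [exact: seminorm_continuous|exact: closed_le].
pose S := [set u : E | `|u| = 1].
have cS : compact S.
  apply: bounded_closed_compact.
    by exists 1; split; rewrite ?num_real // => M M1 u /= ->; exact: ltW.
  apply: (@closed_comp _ _ (fun u : E => `|u|) [set 1]) => [u _|].
    exact: norm_continuous.
  exact: closed_eq.
(* If the sphere is empty, no nonzero vector exists, since it could be normalised. *)
have [S0|/set0P S0] := eqVneq S set0.
  exists 1; split; rewrite ?num_real // => M M1 u _ /=.
  have [->|u0] := eqVneq u 0; first by rewrite normr0 (le_trans ler01) // ltW.
  suff : S (`|u|^-1 *: u) by rewrite S0.
  by rewrite /S /= normrZ normfV normr_id mulVf // normr_eq0.
have [|u0] := compact_EVT_min S0 cS (_ : {within S, continuous n}).
  by apply: continuous_subspaceT; exact: seminorm_continuous.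
rewrite inE /S /= => u01 umin.
have n_gt0 : 0 < n u0.
  rewrite lt_neqAle seminorm_ge0 andbT eq_sym; apply/eqP => /n_eq0 u00.
  by move/eqP: u01; rewrite u00 normr0 eq_sym oner_eq0.
exists (n u0)^-1; split; rewrite ?num_real // => M /ltW M1 u /= nu; apply: le_trans M1.
have [->|uN0] := eqVneq u 0; first by rewrite normr0 invr_ge0 ltW.
rewrite -[leRHS]mul1r ler_pdivlMr // (le_trans _ nu) //.
have := umin (`|u|^-1 *: u); rewrite inE /S /= normrZ normfV normr_id mulVf ?normr_eq0 //.
by move=> /(_ erefl); rewrite nZ normfV normr_id ler_pdivlMl ?normr_gt0.
Qed.

End RealRowVectors.

(** * The dual norm and its basic inequality *)

Section DualNorm.
Variables (R : realType) (k : scalar_kind).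
Local Notation K := (scalars R k).

Lemma real_norm_is_norm (X : normedModType K) : is_norm (@real_norm R k X).
Proof.
split=> [v|v|a v|u v]; rewrite /real_norm.
- by rewrite -(re0 R k) le_re.
- move=> v0; apply/normr0_eq0.
  by rewrite -[LHS](ger0_norm (normr_ge0 v)) scalar_norm normr_id v0 of_real0.
- by rewrite normrZ [`|a|]scalar_norm re_of_realM re_of_real.
- by rewrite -reD le_re // ler_normD.
Qed.

Variables (V : lmodType K) (N : V -> R) (N_norm : is_norm N).
Implicit Types f : V -> K^o.

Lemma is_norm0 : N 0 = 0.
Proof. by have [_ _ NZ _] := N_norm; rewrite -(scale0r 0) NZ re_norm0 mul0r. Qed.

Lemma is_norm_of_realZ r v : N (of_real k r *: v) = `|r| * N v.
Proof. by have [_ _ NZ _] := N_norm; rewrite NZ re_norm_of_real. Qed.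

Let dual_has_sup f : dual N f ->
  has_sup [set re `|f v| | v in [set v | N v <= 1]].
Proof.
move=> [lf [M fM]]; split; first by exists (re `|f 0|), 0 => //=; rewrite is_norm0.
exists `|M| => _ [v /= v1 <-]; rewrite (le_trans (fM v)) //.
have [N0 _ _ _] := N_norm.
by rewrite (le_trans (ler_wpM2r (N0 v) (ler_norm M))) // ler_piMr.
Qed.

Lemma le_dual_norm f v : dual N f -> re `|f v| <= dual_norm N f * N v.
Proof.
move=> df; have [lf _] := df; have [N0 N_eq0 _ _] := N_norm.
have fZ a u : f (a *: u) = a * f u := scalable_linear lf a u.
have [/N_eq0->|Nv] := eqVneq (N v) 0.
  by rewrite -[in leLHS](scale0r 0) fZ mul0r re_norm0 is_norm0 mulr0.
have Nv0 : 0 < N v by rewrite lt_neqAle eq_sym Nv N0.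
rewrite -ler_pdivrMr //; apply: sup_upper_bound; first exact: dual_has_sup.
exists (of_real k (N v)^-1 *: v) => /=.
  by rewrite is_norm_of_realZ gtr0_norm ?invr_gt0 // mulVf.
by rewrite fZ re_normM re_norm_of_real gtr0_norm ?invr_gt0 // mulrC.
Qed.

Lemma dual_norm_le f M : 0 <= M -> (forall v, re `|f v| <= M * N v) ->
  dual_norm N f <= M.
Proof.
move=> M0 fM; apply: ge_sup; first by exists (re `|f 0|), 0 => //=; rewrite is_norm0.
by move=> _ [v /= v1 <-]; rewrite (le_trans (fM v)) // -[leRHS]mulr1 ler_wpM2l.
Qed.

Lemma dual_norm_ge0 f : 0 <= dual_norm N f.
Proof.
have [[S0 uS]|nS] := pselect (has_sup [set re `|f v| | v in [set v | N v <= 1]]).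
  apply: (@le_trans _ _ (re `|f 0|)); first exact: re_norm_ge0.
  by apply: ub_le_sup => //; exists 0 => //=; rewrite is_norm0.
(* A set with no supremum gets the default value 0. *)
by rewrite /dual_norm sup_out.
Qed.

End DualNorm.

(** * Compact unit balls and bounded functionals in finite dimension *)

Section FiniteDimension.
Variables (R : realType) (k : scalar_kind).
Local Notation K := (scalars R k).
Variables (Y : vectType K) (N : Y -> R) (N_norm : is_norm N).
Variables (m : nat) (phi : 'rV[R]_m -> Y).
Hypotheses (phi_inj : injective phi) (phiD : {morph phi : u v / u + v}).
Hypothesis phiZ : forall r u, phi (r *: u) = of_real k r *: phi u.

Let NphiD u v : N (phi (u + v)) <= N (phi u) + N (phi v).
Proof. by have [_ _ _ ND] := N_norm; rewrite phiD. Qed.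

Let NphiZ r u : N (phi (r *: u)) = `|r| * N (phi u).
Proof. by rewrite phiZ is_norm_of_realZ. Qed.

Lemma is_norm_ball_compact : compact [set u | N (phi u) <= 1].
Proof.
apply: norm_ball_compact NphiD NphiZ _ => u.
have [_ N_eq0 _ _] := N_norm => /N_eq0 pu; apply: phi_inj.
by rewrite pu -(scale0r (0 : 'rV[R]_m)) phiZ of_real0 scale0r.
Qed.

End FiniteDimension.

(** The modulus of [f] is continuous in coordinates, so it has a maximum on the compact unit ball of
    [N]; this maximum is the bound sought. *)
Lemma finite_dim_dual (R : realType) (k : scalar_kind) (Y : vectType (scalars R k))
    (N : Y -> R) (f : Y -> (scalars R k)^o) :
  is_norm N -> scalar f -> dual N f.
Proof.
move=> N_norm lf; split=> //.
have [m [phi [psi [phiK psiK phiD phiZ]]]] := real_coordinates Y.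
have fD u v : f (u + v) = f u + f v by rewrite -[u]scale1r lf mul1r scale1r.
have fZ a u : f (a *: u) = a * f u := scalable_linear lf a u.
have f0 : f 0 = 0 by rewrite -(scale0r 0) fZ mul0r.
have cf : continuous (fun u => re `|f (phi u)|).
  apply: seminorm_continuous => [u v|r u]; first by rewrite phiD fD re_normD.
  by rewrite phiZ fZ re_normM re_norm_of_real.
have cN := is_norm_ball_compact N_norm (can_inj phiK) phiD phiZ.
have phi0 : phi 0 = 0 by rewrite -(scale0r (0 : 'rV[R]_m)) phiZ of_real0 scale0r.
have B0 : [set u | N (phi u) <= 1] !=set0 by exists 0; rewrite /= phi0 is_norm0.
have [u _ umax] := compact_EVT_max B0 cN (continuous_subspaceT cf).
exists (re `|f (phi u)|) => v; have [N0 N_eq0 _ _] := N_norm.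
have [/N_eq0->|Nv] := eqVneq (N v) 0.
  by rewrite f0 re_norm0 is_norm0 // mulr0.
have Nv0 : 0 < N v by rewrite lt_neqAle eq_sym Nv N0.
have := umax (psi (of_real k (N v)^-1 *: v)); rewrite inE /= psiK.
rewrite is_norm_of_realZ // fZ re_normM re_norm_of_real gtr0_norm ?invr_gt0 //.
by rewrite mulVf // => /(_ (lexx _)); rewrite ler_pdivrMl // mulrC.
Qed.

(** The dual consists of bare functions, whereas coordinates require a finite-dimensional type;
    functionals are moved to ['Hom] for that purpose. *)
Lemma hom_of_scalar (K : fieldType) (Y : vectType K) (f : Y -> K^o) :
  scalar f -> exists g : 'Hom(Y, K^o), g = f :> (Y -> K^o).
Proof.
move=> lf; pose l := GRing.isLinear.Build K Y K^o *%R f lf.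
pose F : {linear Y -> K^o} := HB.pack f l.
by exists (linfun F); apply/funext => y; rewrite lfunE.
Qed.

(** * Strict convexity of the squared Euclidean norm *)

Section EuclideanNorm.
Variables (R : realType) (m : nat).
Implicit Types u v : 'rV[R]_m.

Definition sqr_norm u : R := \sum_i u 0 i ^+ 2.

Lemma sqr_norm_continuous : continuous sqr_norm.
Proof.
apply: (@continuous_quadratic _ _ (fun u v => \sum_i u 0 i * v 0 i)).
- by move=> u v w; rewrite -big_split; apply: eq_bigr => i _; rewrite mxE mulrDr.
- by move=> u v w; rewrite -big_split; apply: eq_bigr => i _; rewrite mxE mulrDl.
- by move=> r u v; rewrite mulr_sumr; apply: eq_bigr => i _; rewrite mxE mulrCA.
- by move=> r u v; rewrite mulr_sumr; apply: eq_bigr => i _; rewrite mxE mulrA.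
Qed.

(** The squared norm of [w] falls short of the convex combination of those of [u] and [v] by
    [s * (1 - s) * sqr_norm (u - v)]. Hence a longest point of a set is interior to no proper
    segment with endpoints in the set. *)
Lemma sqr_norm_strictly_convex (s : R) u v : 0 < s < 1 ->
  let w := s *: u + (1 - s) *: v in
  sqr_norm u <= sqr_norm w -> sqr_norm v <= sqr_norm w -> u = v.
Proof.
move=> /andP[s0 s1] w uw vw.
have wE : sqr_norm w = s * sqr_norm u + (1 - s) * sqr_norm v
                       - s * (1 - s) * sqr_norm (u - v).
  rewrite /sqr_norm !mulr_sumr -big_split -sumrB; apply: eq_bigr => i _ /=.
  by rewrite /w !mxE; ring.
have : sqr_norm (u - v) <= 0.
  rewrite -(pmulr_rle0 _ (_ : 0 < s * (1 - s))); first by nra.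
  by rewrite mulr_gt0 ?subr_gt0.
move=> d0; apply/rowP => i; apply/eqP; rewrite -subr_eq0 -sqrf_eq0; apply/eqP/le_anti.
rewrite sqr_ge0 andbT (le_trans _ d0) // /sqr_norm (bigD1 i) //= !mxE lerDl.
by apply: sumr_ge0 => j _; exact: sqr_ge0.
Qed.

End EuclideanNorm.

(** * States, their compactness, and extreme maximisers *)

Section Operators.
Variables (R : realType) (k : scalar_kind).
Local Notation K := (scalars R k).
Variable X : finDimBanachType K.
Implicit Types (A B T : 'L(X)) (x : X).

Lemma bounded_op_linear A : linear A.
Proof. by case: A => A /= /asboolP[]. Qed.

Lemma bounded_opD A B x : (A + B) x = A x + B x.
Proof. by []. Qed.

Lemma bounded_opZ (a : K) A x : (a *: A) x = a *: A x.
Proof. by []. Qed.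

Local Notation Y := (X * 'Hom(X, K^o))%type.
Implicit Types p q : Y.

(** The maximum makes the unit ball the product of the two unit balls. *)
Definition pair_norm p : R :=
  Num.max (real_norm p.1) (dual_norm (@real_norm R k X) p.2).

Lemma hom_dual (f : 'Hom(X, K^o)) : dual (@real_norm R k X) f.
Proof. by apply: finite_dim_dual => [|a u v]; [exact: real_norm_is_norm|rewrite linearP]. Qed.

Lemma norm_hom_le (f : 'Hom(X, K^o)) x :
  re `|f x| <= dual_norm (@real_norm R k X) f * real_norm x.
Proof. by apply: le_dual_norm; [exact: real_norm_is_norm|exact: hom_dual]. Qed.

Lemma dual_norm_is_norm :
  is_norm (fun f : 'Hom(X, K^o) => dual_norm (@real_norm R k X) f).
Proof.
have [N0 _ _ _] := @real_norm_is_norm R k X.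
have dn0 := dual_norm_ge0 (@real_norm_is_norm R k X).
have dle f M := @dual_norm_le R k X _ (@real_norm_is_norm R k X) f M.
have dZ (a : K) (f : 'Hom(X, K^o)) :
    dual_norm (@real_norm R k X) (a *: f : 'Hom(X, K^o)) <=
    re `|a| * dual_norm (@real_norm R k X) f.
  apply: dle => [|v]; first by rewrite mulr_ge0 ?re_norm_ge0.
  by rewrite scale_lfunE re_normM -mulrA ler_wpM2l ?re_norm_ge0 // norm_hom_le.
split=> [//|f f0|a f|f g].
- apply/lfunP => v; rewrite zero_lfunE; apply: re_norm_eq0; apply/le_anti.
  by rewrite re_norm_ge0 (le_trans (norm_hom_le _ _)) // f0 mul0r.
- apply/le_anti; rewrite dZ /=.
  have [->|a0] := eqVneq a 0; first by rewrite re_norm0 mul0r dn0.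
  (* The reverse inequality is [dZ] for the inverse of [a], applied to [a *: f]. *)
  rewrite -[in leLHS](scalerK a0 f); apply: (le_trans (ler_wpM2l (re_norm_ge0 _) (dZ _ _))).
  by rewrite mulrA -re_normM divff // re_norm1 mul1r.
- apply: dle => [|v]; first by rewrite addr_ge0.
  by rewrite add_lfunE (le_trans (re_normD _ _)) // mulrDl lerD ?norm_hom_le.
Qed.

Lemma pair_norm_is_norm : is_norm pair_norm.
Proof.
have [N0 N_eq0 NZ ND] := @real_norm_is_norm R k X.
have [D0 D_eq0 DZ DD] := dual_norm_is_norm.
split=> [[x f]|[x f]|a [x f]|[x f] [y g]]; rewrite /pair_norm /=.
- by rewrite le_max N0.
- move=> xf0; congr pair; [apply: N_eq0|apply: D_eq0]; apply/le_anti.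
    by rewrite N0 -xf0 le_max lexx.
  by rewrite D0 -xf0 le_max lexx orbT.
- by rewrite NZ DZ maxr_pMr ?re_norm_ge0.
- by rewrite ge_max (le_trans (ND _ _)) ?(le_trans (DD _ _)) ?lerD ?le_max ?lexx ?orbT.
Qed.

(* Up to a unimodular scalar, the pairs over which the numerical radius is a sup. *)
Definition state p : Prop :=
  [/\ real_norm p.1 <= 1, dual_norm (@real_norm R k X) p.2 <= 1
    & 1 <= re `|p.2 p.1|].

(** For [a = numradius A] these are the maximisers of the real part; for [A = 0] and [a = 0] they
    are all the states. *)
Definition states_above A (a : R) : set Y :=
  [set p | state p /\ a <= re (p.2 (A p.1))].

(** The product of two norms at most 1 bounds a modulus at least 1, so all three equal 1. *)
Lemma state_norm p : state p ->
  [/\ real_norm p.1 = 1, dual_norm (@real_norm R k X) p.2 = 1 & re `|p.2 p.1| = 1].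
Proof.
case: p => x f [/= x1 f1 fx1]; have := norm_hom_le f x.
have [N0 _ _ _] := @real_norm_is_norm R k X; have [D0 _ _ _] := dual_norm_is_norm.
have := N0 x; have := D0 f => /= *; split; nra.
Qed.

Section Coordinates.
Variables (m : nat) (phi : 'rV[R]_m -> Y).
Hypotheses (phi_inj : injective phi) (phiD : {morph phi : u v / u + v}).
Hypothesis phiZ : forall r u, phi (r *: u) = of_real k r *: phi u.

(** A real-linear [h] covers real and imaginary parts at once; the pairing is a quadratic form in
    the real coordinates. *)
Lemma pairing_continuous A (h : K -> R) :
  (forall a b, h (a + b) = h a + h b) ->
  (forall r a, h (of_real k r * a) = r * h a) ->
  continuous (fun u => h ((phi u).2 (A (phi u).1))).
Proof.
move=> hD hZ; have lA := bounded_op_linear A.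
have AD x y : A (x + y) = A x + A y by rewrite -[x]scale1r lA !scale1r.
have AZ a x : A (a *: x) = a *: A x := scalable_linear lA a x.
apply: (@continuous_quadratic _ _ (fun u v => h ((phi u).2 (A (phi v).1)))).
- by move=> u v w; rewrite phiD /= AD linearD hD.
- by move=> u v w; rewrite phiD /= add_lfunE hD.
- by move=> r u v; rewrite phiZ /= AZ linearZ hZ.
- by move=> r u v; rewrite phiZ /= scale_lfunE hZ.
Qed.

Lemma states_above_compact A a : compact (phi @^-1` states_above A a).
Proof.
(* With the identity as operator, [p.2 p.1] itself becomes a pairing. *)
have lid : is_bounded_linear (id : X -> X).
  by apply/asboolP; split=> //; exists 1 => x; rewrite mul1r.
have cre B := pairing_continuous (A := B) (@reD R k) (@re_of_realM R k).
have cim B := pairing_continuous (A := B) (@imD R k) (@im_of_realM R k).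
(* The modulus is squared so that it becomes a sum of squares of continuous functions. *)
have -> : phi @^-1` states_above A a =
    [set u | pair_norm (phi u) <= 1] `&`
    ((fun u => re `|(phi u).2 (phi u).1| ^+ 2) @^-1` [set r | 1 <= r] `&`
     (fun u => re ((phi u).2 (A (phi u).1))) @^-1` [set r | a <= r]).
  apply/funext => u; apply/propext; rewrite /states_above /state /pair_norm /=.
  rewrite ge_max -[X in X <= _ ^+ 2](expr1n _ 2) ler_sqr ?nnegrE ?re_norm_ge0 //.
  by split=> [[[-> -> ?] ?]|[/andP[-> ->] [? ?]]].
apply: compact_closedI.
  exact (is_norm_ball_compact pair_norm_is_norm phi_inj phiD phiZ).
apply: closedI; apply: closed_comp; try exact: closed_ge.
- move=> u _; have -> : (fun u => re `|(phi u).2 (phi u).1| ^+ 2) =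
    (fun u => re ((phi u).2 (BoundedOp lid (phi u).1)) ^+ 2
            + im ((phi u).2 (BoundedOp lid (phi u).1)) ^+ 2).
    by apply/funext => v; rewrite sqr_re_norm.
  have sq (g : 'rV[R]_m -> R) : {for u, continuous g} ->
      {for u, continuous (fun v => g v ^+ 2 : R)}.
    by move=> cg; exact: (continuousM cg cg).
  exact (continuousD (sq _ (cre (BoundedOp lid) u)) (sq _ (cim (BoundedOp lid) u))).
- by move=> u _; exact: cre.
Qed.

End Coordinates.

Lemma states_above_max A a B : states_above A a !=set0 ->
  exists2 p, states_above A a p &
    forall q, states_above A a q -> re (q.2 (B q.1)) <= re (p.2 (B p.1)).
Proof.
move=> [p0 Cp0]; have [m [phi [psi [phiK psiK phiD phiZ]]]] := real_coordinates Y.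
have [|u] := compact_EVT_max _
  (states_above_compact (can_inj phiK) phiD phiZ (A := A) (a := a))
  (continuous_subspaceT
    (pairing_continuous phiD phiZ (A := B) (@reD R k) (@re_of_realM R k))).
  by exists (psi p0); rewrite /= psiK.
rewrite inE => Cu umax; exists (phi u) => // q Cq.
by have := umax (psi q); rewrite inE /= psiK; apply.
Qed.

(** The bound on all states makes [states_above A a] the set of maximisers; a longest one in
    coordinates is taken. *)
Lemma states_above_extreme A a : states_above A a !=set0 ->
  (forall q, state q -> re (q.2 (A q.1)) <= a) ->
  exists p, [/\ states_above A a p, extreme_X p.1 & extreme_dual p.2].
Proof.
move=> [p0 Cp0] a_max.
have [m [phi [psi [phiK psiK phiD phiZ]]]] := real_coordinates Y.
have [|u] := compact_EVT_max _
  (states_above_compact (can_inj phiK) phiD phiZ (A := A) (a := a))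
  (continuous_subspaceT (@sqr_norm_continuous R m)).
  by exists (psi p0); rewrite /= psiK.
rewrite inE => Cu umax; set p := phi u in Cu.
have pE : psi p = u by rewrite /p phiK.
have [[[x1 f1 _] _] lA] := (Cu, bounded_op_linear A).
(* The pairings are bilinear, hence affine along a segment only when one component is fixed; their
   affine expansions are therefore assumed, which serves both components. *)
have face (p1 p2 : Y) s : 0 < s < 1 ->
    pair_norm p1 <= 1 -> pair_norm p2 <= 1 ->
    p.2 p.1 = of_real k s * p1.2 p1.1 + of_real k (1 - s) * p2.2 p2.1 ->
    p.2 (A p.1) = of_real k s * p1.2 (A p1.1) + of_real k (1 - s) * p2.2 (A p2.1) ->
    p = of_real k s *: p1 + of_real k (1 - s) *: p2 ->
  p1 = p /\ p2 = p.
  move=> s01; have /andP[s0 s1] := s01.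
  have unit_pairing q : pair_norm q <= 1 -> re `|q.2 q.1| <= 1.
    rewrite ge_max => /andP[q1 q2]; rewrite (le_trans (norm_hom_le _ _)) //.
    have [N0 _ _ _] := @real_norm_is_norm R k X.
    apply: mulr_ile1 => //.
    exact: dual_norm_ge0 (@real_norm_is_norm R k X) _.
  have above q : pair_norm q <= 1 -> 1 <= re `|q.2 q.1| -> a <= re (q.2 (A q.1)) ->
      states_above A a q.
    by rewrite ge_max => /andP[].
  have below q : pair_norm q <= 1 -> 1 <= re `|q.2 q.1| -> re (q.2 (A q.1)) <= a.
    by rewrite ge_max => /andP[? ?] ?; apply: a_max.
  move=> n1 n2 e1 e2 e3.
  have [[_ _ pn] pa] := Cu.
  have u1 := unit_pairing _ n1; have u2 := unit_pairing _ n2.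
  (* A proper convex combination reaching the common upper bound of its terms forces each term to
     reach it. This makes both endpoints states and then, with bound [a], maximisers. *)
  have : 1 <= s * re `|p1.2 p1.1| + (1 - s) * re `|p2.2 p2.1|.
    apply: (le_trans pn); rewrite e1 (le_trans (re_normD _ _)) // !re_normM.
    by rewrite !re_norm_of_real (gtr0_norm s0) (gtr0_norm (_ : 0 < 1 - s)) // subr_gt0.
  move=> sum1; have v1 : 1 <= re `|p1.2 p1.1| by nra.
  have v2 : 1 <= re `|p2.2 p2.1| by nra.
  have b1 := below _ n1 v1; have b2 := below _ n2 v2.
  have : a <= s * re (p1.2 (A p1.1)) + (1 - s) * re (p2.2 (A p2.1)).
    by apply: (le_trans pa); rewrite e2 reD !re_of_realM.
  move=> sum2; have C1 : states_above A a p1 by apply: above => //; nra.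
  have C2 : states_above A a p2 by apply: above => //; nra.
  have uE : u = s *: psi p1 + (1 - s) *: psi p2.
    by apply: (can_inj phiK); rewrite phiD !phiZ !psiK.
  (* Both endpoints are maximisers, hence no longer than [u]. *)
  have p12 : p1 = p2.
    apply: (can_inj psiK); apply: (sqr_norm_strictly_convex s01); rewrite -uE;
    by apply: umax; rewrite inE /= psiK.
  by rewrite e3 -p12 -scalerDl -of_realD subrKC of_real1 scale1r.
have one_sub s : 1 - of_real k s = of_real k (1 - s).
  by rewrite of_realD of_realN of_real1.
have convK (W : lmodType K) s (w : W) :
    w = of_real k s *: w + of_real k (1 - s) *: w.
  by rewrite -scalerDl -of_realD subrKC of_real1 scale1r.
exists p; split=> //.
- split=> // y z t /= y1 z1 /scalar_unit_interval[s s01 ->]; rewrite one_sub => xE.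
  have [||||/= |[]] := face (y, p.2) (z, p.2) s s01.
  + by rewrite ge_max y1.
  + by rewrite ge_max z1.
  + by rewrite xE linearD !linearZ.
  + by rewrite xE lA (scalable_linear lA) linearD !linearZ.
  + rewrite [LHS]surjective_pairing [RHS]surjective_pairing.
    congr pair; [exact: xE|exact: convK].
- by move=> <- [<-].
- split; first by split=> //; exact: hom_dual.
  move=> g h t [dg g1] [dh h1] /scalar_unit_interval[s s01 ->]; rewrite one_sub => fE.
  have [[G GE] [H HE]] := (hom_of_scalar dg.1, hom_of_scalar dh.1).
  rewrite -{}GE in g1 fE *; rewrite -{}HE in h1 fE *.
  have fEx v : p.2 v = of_real k s * G v + of_real k (1 - s) * H v by rewrite fE.
  have [||||/= |[]] := face (p.1, G) (p.1, H) s s01.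
  + by rewrite ge_max x1.
  + by rewrite ge_max x1.
  + exact: fEx.
  + exact: fEx.
  + rewrite [LHS]surjective_pairing [RHS]surjective_pairing.
    congr pair; first exact: convK.
    by apply/lfunP => v; rewrite add_lfunE !scale_lfunE fEx.
- by move=> <- [<-].
Qed.

End Operators.

(** * The numerical radius through states, and support functionals at smooth points *)

Section NumericalRadius.
Variables (R : realType) (k : scalar_kind).
Local Notation K := (scalars R k).
Variable X : finDimBanachType K.
Implicit Types (A B T U : 'L(X)) (p q : X * 'Hom(X, K^o)).

Let numradius_set T := [set r | exists (f : X -> K^o) (x : X),
  [/\ sphere_dual f, sphere_X x, f x = 1 & r = re `|f (T x)|]].

Lemma unimodular_norm (F : numFieldType) (z : F) :
  exists2 c : F, `|c| = 1 & c * z = `|z|.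
Proof.
have [->|z0] := eqVneq z 0; first by exists 1; rewrite ?normr1 // mulr0 normr0.
exists (`|z| / z); last by rewrite divfK.
by rewrite normrM normfV normr_id divff // normr_eq0.
Qed.

Lemma numradius_has_ubound T : has_ubound (numradius_set T).
Proof.
have /asboolP[_ [M TM]] := valP T.
exists (re M) => _ [f [x [[df f1] x1 _ ->]]].
rewrite (le_trans (le_dual_norm (@real_norm_is_norm R k X) _ df)) // f1 mul1r.
apply: le_re; rewrite (le_trans (TM x)) //.
have -> : `|x| = 1.
  by rewrite -[LHS](ger0_norm (normr_ge0 x)); apply: norm_re1; rewrite normr_id.
by rewrite mulr1.
Qed.

(** Dividing the functional by the unimodular number [p.2 p.1] gives a pair of the kind used in
    [numradius]. *)
Lemma state_rotate p : state p ->
  exists (c : K) (f : X -> K^o),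
   [/\ `|c| = 1, sphere_dual f, f p.1 = 1 & forall y, f y = c * p.2 y].
Proof.
move=> sp; have [x1 f1 /norm_re1 fx1] := state_norm sp.
have c1 : `|(p.2 p.1)^-1 : K| = 1 by rewrite normfV fx1 invr1.
exists (p.2 p.1)^-1, ((p.2 p.1)^-1 *: p.2 : 'Hom(X, K^o)).
have [_ _ DZ _] := @dual_norm_is_norm R k X.
split=> [//|||y]; rewrite ?scale_lfunE //.
- by split; [exact: hom_dual|rewrite DZ c1 re1 mul1r].
- by rewrite [LHS]mulVf // -normr_eq0 fx1 oner_eq0.
Qed.

Lemma state_le_numradius T p : state p -> re `|p.2 (T p.1)| <= numradius T.
Proof.
move=> sp; have [x1 _ _] := state_norm sp.
have [c [f [c1 sf fx fE]]] := state_rotate sp.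
apply: ub_le_sup; first exact: numradius_has_ubound.
by exists f, p.1; split=> //; rewrite fE normrM c1 mul1r.
Qed.

(** Over an empty set [sup] is 0, so positivity provides an admissible pair. *)
Lemma state_exists T : 0 < numradius T -> exists p, state p.
Proof.
move=> wT; have [S0|/set0P[_ [f [x [[df f1] x1 fx _]]]]] := eqVneq (numradius_set T) set0.
  by move: wT; rewrite /numradius -/(numradius_set T) S0 sup0 ltxx.
have [F FE] := hom_of_scalar df.1.
by exists (x, F); split; rewrite /= ?FE ?f1 ?x1 // fx re_norm1.
Qed.

(** A state maximising the real part exists by compactness. It dominates every modulus, because
    rotating a functional by a unimodular scalar keeps a state and makes its value the modulus. *)
Lemma numradius_attained T : (exists p, state p) ->
  exists2 p, state p & numradius T <= re (p.2 (T p.1)).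
Proof.
move=> [p0 sp0].
have above0 p : state p -> states_above (0 : 'L(X)) 0 p.
  by move=> sp; split; rewrite //= linear0 re0.
have [|p [sp _] pmax] := @states_above_max R k X 0 0 T; first by exists p0; apply: above0.
exists p => //; apply: ge_sup.
  have [x1 _ _] := state_norm sp0; have [c [f [_ sf fx _]]] := state_rotate sp0.
  by exists (re `|f (T p0.1)|), f, p0.1.
move=> _ [f [x [[df f1] x1 fx ->]]]; have [F FE] := hom_of_scalar df.1.
have [c c1 cE] := unimodular_norm (f (T x)).
have [_ _ DZ _] := @dual_norm_is_norm R k X.
rewrite -cE; have := pmax (x, c *: F); rewrite /= scale_lfunE FE; apply.
apply: above0; split; rewrite /= ?x1 ?DZ ?FE ?f1 ?c1 ?re1 ?mul1r //.
by rewrite scale_lfunE FE fx re_normM c1 re_norm1 re1 mulr1.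
Qed.

(** Every state bounds the value at [A] by [numradius A], so the dual norm is at most 1; the value
    at [U] shows that it is at least 1. *)
Lemma state_support_functional U p :
  is_norm (@numradius R k X) -> 0 < numradius U -> states_above U (numradius U) p ->
  support_functionals_w U (fun A => p.2 (A p.1)).
Proof.
move=> w_norm wU [sp pU]; have pw A := state_le_numradius A sp.
have dp : dual (@numradius R k X) (fun A => p.2 (A p.1)).
  split; last by exists 1 => A; rewrite mul1r.
  by move=> a A B; rewrite /= linearP.
have pUE : p.2 (U p.1) = of_real k (numradius U) by exact: re_attains_norm.
split=> //; apply/le_anti/andP; split.
  by apply: dual_norm_le => // A; rewrite mul1r.
have := le_dual_norm w_norm U dp; rewrite /= pUE re_norm_of_real gtr0_norm //.
by rewrite -[X in X <= _]mul1r ler_pM2r.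
Qed.

(** At numerical radius 0 the opposite of a support functional is again one; uniqueness would make
    it zero, against norm 1. *)
Lemma nu_smooth_numradius_gt0 U :
  is_norm (@numradius R k X) -> nu_smooth U -> 0 < numradius U.
Proof.
move=> w_norm [F FJ]; have [w0 _ _ _] := w_norm.
rewrite lt_neqAle w0 andbT eq_sym; apply/eqP => wU.
have [[lF [M FM]] F1 FU] : support_functionals_w U F by rewrite FJ.
have : support_functionals_w U (fun A => - F A).
  split; last by rewrite FU wU of_real0 oppr0.
    split; last by exists M => A; rewrite normrN.
    by move=> a A B; rewrite lF opprD mulrN.
  rewrite -F1; congr (sup _); apply/seteqP.
  by split=> _ [A A1 <-]; exists A; rewrite ?normrN.
rewrite FJ => FN.
have F0 A : F A = 0 by apply/eqP; rewrite -eqNr -[X in _ == X A]FN.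
have : dual_norm (@numradius R k X) F <= 0.
  by apply: dual_norm_le => // A; rewrite F0 re_norm0 mul0r.
by rewrite F1 ler10.
Qed.

(* Compactness of the set of states replaces the Hahn-Banach theorem here. *)
Lemma support_functional_ge0 U A F :
  is_norm (@numradius R k X) -> 0 < numradius U ->
  support_functionals_w U = [set F] ->
  (forall t : R, 0 < t -> numradius U <= numradius (U + of_real k t *: A)) ->
  0 <= re (F A).
Proof.
move=> w_norm wU FJ wUA.
have approx t : 0 < t -> exists2 p, states_above A 0 p &
    numradius U <= re (p.2 (U p.1)) + t * numradius A.
  move=> t0; have [p sp] := numradius_attained (U + of_real k t *: A) (state_exists wU).
  rewrite bounded_opD bounded_opZ linearD linearZ reD [re (_ *: _)]re_of_realM => pw.
  have {}pw := le_trans (wUA t t0) pw.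
  have pU : re (p.2 (U p.1)) <= numradius U.
    exact: le_trans (ler_re_norm _) (state_le_numradius U sp).
  have pA : re (p.2 (A p.1)) <= numradius A.
    exact: le_trans (ler_re_norm _) (state_le_numradius A sp).
  exists p; last by rewrite (le_trans pw) // lerD2l ler_pM2l.
  (* The value at [U] is at most [numradius U], so the term with factor [t] must be nonnegative. *)
  by split=> //; rewrite -(pmulr_rge0 _ t0); lra.
(* Instead of extracting a limit, the best state for [U] among those nonnegative at [A] is taken; it
   does at least as well as each approximate one. *)
have [|p [sp pA] pmax] := @states_above_max R k X A 0 U.
  by have [p Cp _] := approx 1 ltr01; exists p.
suff pU : numradius U <= re (p.2 (U p.1)).
  have : [set F] (fun B => p.2 (B p.1)).
    by rewrite -FJ; exact: state_support_functional.
  by move=> /= <-.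
apply/ler_addgt0Pr => e e0.
have [wA _ _ _] := w_norm.
(* This choice of [t] makes the error at most [e], even if [numradius A] is 0. *)
have [|q Cq qU] := approx (e / (numradius A + 1)).
  by rewrite divr_gt0 // ltr_wpDl.
rewrite (le_trans qU) // lerD ?pmax // mulrAC ler_pdivrMr ?ltr_wpDl //.
by rewrite ler_pM2l // lerDl.
Qed.

(** If [F A] were nonzero, some scalar multiple of [A], still in [V], would have value -1 under [F],
    against nonnegativity. *)
Lemma support_functional_annihilates U F (V : {pred 'L(X)}) :
  is_norm (@numradius R k X) -> 0 < numradius U -> submod_closed V ->
  support_functionals_w U = [set F] ->
  (forall A, A \in V -> numradius U <= numradius (U - A)) ->
  forall A, A \in V -> F A = 0.
Proof.
move=> w_norm wU [V0 V_lin] FJ wUV A AV; apply: contrapT => FA0.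
have VZ (a : K) : a *: A \in V by rewrite -[_ *: _]addr0 V_lin.
have : 0 <= re (F (- (F A)^-1 *: A)).
  apply: support_functional_ge0 w_norm wU FJ _ => t t0.
  by rewrite scalerA -[_ *: A]opprK -scaleNr wUV.
have [[lF _] _ _] : support_functionals_w U F by rewrite FJ.
have FZ (a : K) : F (a *: A) = a * F A := scalable_linear lF a A.
rewrite FZ mulNr mulVf; last exact/eqP.
by rewrite -[- 1]/(- (1 : K)) -of_real1 -of_realN re_of_real oppr_ge0 ler10.
Qed.

End NumericalRadius.

Theorem theorem3p8 (R : realType) (k : scalar_kind)
    (X : finDimBanachType (scalars R k))
    (w_norm : is_norm (@numradius R k X))
    (T : 'L(X)) (V : {pred 'L(X)}) (V_sub : submod_closed V)
    (smooth : exists S, best_approx_w T V S /\ nu_smooth (T - S)) :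
  is_max
    [set z : scalars R k | exists (x : X) (f : X -> (scalars R k)^o),
       [/\ extreme_X x, extreme_dual f, `|f x| = 1, im (f (T x)) = 0
         & (forall A, A \in V -> f (A x) = 0) /\ z = f (T x)]]
    (of_real k (dist_w T V)).
Proof.
have [S [[SV wS] smoothU]] := smooth; set U := T - S in smoothU wS.
have [w0 _ _ _] := w_norm.
have wU := nu_smooth_numradius_gt0 w_norm smoothU.
have [F FJ] := smoothU.
have [V0 V_lin] := V_sub.
have VD A B : A \in V -> B \in V -> A + B \in V.
  by move=> AV BV; rewrite -[A]scale1r V_lin.
(* [U - A] is [T - (S + A)], and [S + A] competes in the infimum. *)
have best A : A \in V -> numradius U <= numradius (U - A).
  move=> AV; rewrite wS /U -addrA -opprD; apply: ge_inf.
    by exists 0 => _ [B _ <-].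
  by exists (S + A) => //=; apply: VD.
have F0 := support_functional_annihilates w_norm wU V_sub FJ best.
have UE x : U x = T x - S x by [].
split.
  have [p sp pU] := numradius_attained U (state_exists wU).
  have [||q [[sq qU] ex ef]] := @states_above_extreme R k X U (numradius U).
  - by exists p.
  - by move=> q sq; apply: le_trans (ler_re_norm _) (state_le_numradius U sq).
  have FE : [set F] (fun B => q.2 (B q.1)).
    by rewrite -FJ; exact: state_support_functional.
  have qV A : A \in V -> q.2 (A q.1) = 0 by move=> AV; rewrite -(F0 _ AV) -FE.
  (* The functional of [q] is [F], which vanishes at [S], so [T] and [U] have the same value. *)
  have qT : q.2 (T q.1) = of_real k (dist_w T V).
    rewrite -wS -(re_attains_norm (state_le_numradius U sq) qU) UE linearB /=.
    by rewrite (qV _ SV) subr0.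
  exists q.1, q.2; split=> //.
  - by have [_ _ /norm_re1] := state_norm sq.
  - by rewrite qT im_of_real.
(* Upper bound: an admissible pair is a state vanishing at [S], and its value at [T] is real, hence
   comparable with the distance. *)
move=> _ [x [f [[x1 _] [[df f1] _] fx im0 [fV ->]]]].
apply: le_of_real => //; rewrite -wS.
have [G GE] := hom_of_scalar df.1.
have sxG : state (x, G) by split; rewrite /= ?GE // fx re1.
have -> : f (T x) = G (U x) by rewrite UE linearB /= GE (fV _ SV) subr0.
exact: le_trans (ler_re_norm _) (state_le_numradius U sxG).
Qed.
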